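(* Let $\mathbf B=(B;w^{\mathbf B})$ be an algebra with $n$-ary basic operation $w^{\mathbf B}$, let $p$ be prime, and let $\mathbf A\in(\mathbf B\boxtimes\mathbb Z_p)\cap\mathcal V_n$. If $w^{\mathbf B}$ is XY-symmetric, then there exists a term $t$ of arity $n$ such that $t^{\mathbf A}$ is XY-symmetric.
   Context: For $x=(a,b)$ write $x^{(1)}=a$, $x^{(2)}=b$. $\mathbf B\boxtimes\mathbb Z_p$ is the set of algebras $\mathbf A=(B\times\mathbb Z_p;w^{\mathbf A})$ with $n$-ary operation such that $(w^{\mathbf A}(x_1,\dots,x_n))^{(1)}=w^{\mathbf B}(x_1^{(1)},\dots,x_n^{(1)})$ and $(w^{\mathbf A}(x_1,\dots,x_n))^{(2)}=f(x_1^{(1)},\dots,x_n^{(1)})+a_1x_1^{(2)}+\dots+a_nx_n^{(2)}$ for some map $f\colon B^n\to\mathbb Z_p$ and $a_1,\dots,a_n\in\mathbb Z_p$. $\mathcal V_n$ is the class of finite algebras with a single $n$-ary operation $w$ that is an idempotent special WNU: $w(x,\dots,x)=x$, $w(y,x,\dots,x)=\dots=w(x,\dots,x,y)$, and $w(x,\dots,x,y)=w(x,\dots,x,w(x,\dots,x,y))$. Terms are built from the symbol $w$. An $n$-ary operation is XY-symmetric if for each $i$ it takes the same value on all tuples in $\{x,y\}^n$ having exactly $i$ entries equal to $x$. *)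

(* Defs.v *)
From mathcomp Require Import all_boot all_algebra.

Set Implicit Arguments.
Unset Strict Implicit.
Unset Printing Implicit Defensive.

Import GRing.Theory.
Local Open Scope ring_scope.

(* An algebra with a single n-ary operation is given by its carrier A together
   with an operation w : operation n A. *)
Definition operation (n : nat) (A : Type) : Type := {ffun 'I_n -> A} -> A.

(* Terms over the symbol w of arity n in the variables x_0, ..., x_(m-1), i.e.
   terms of arity m. *)
Inductive term (n m : nat) : Type :=
| Var of 'I_m
| App of ('I_n -> term n m).

Fixpoint term_op (n m : nat) (A : Type) (w : operation n A) (t : term n m)
    (x : {ffun 'I_m -> A}) : A :=
  match t with
  | Var i => x i
  | App s => w [ffun k => term_op w (s k) x]
  end.

(* The tuple (x, ..., x, y, x, ..., x) with y at position i. *)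
Definition all_but_one (n : nat) (A : Type) (x y : A) (i : 'I_n) :
    {ffun 'I_n -> A} :=
  [ffun k => if k == i then y else x].

Definition idempotent_operation (n : nat) (A : Type) (w : operation n A) : Prop :=
  forall x : A, w [ffun=> x] = x.

Definition weak_near_unanimity (n : nat) (A : Type) (w : operation n A) : Prop :=
  forall (x y : A) (i j : 'I_n), w (all_but_one x y i) = w (all_but_one x y j).

(* The hypothesis i.+1 = n says that i is the last position. *)
Definition special_operation (n : nat) (A : Type) (w : operation n A) : Prop :=
  forall (x y : A) (i : 'I_n), i.+1 = n ->
    w (all_but_one x y i) = w (all_but_one x (w (all_but_one x y i)) i).

(* Membership of the finite algebra (A; w) in the class V_n. *)
Definition in_V (n : nat) (A : finType) (w : operation n A) : Prop :=
  [/\ idempotent_operation w, weak_near_unanimity w & special_operation w].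

Definition XY_symmetric (n : nat) (A : eqType) (w : operation n A) : Prop :=
  forall (x y : A) (u v : {ffun 'I_n -> A}),
    (forall k, u k \in [:: x; y]) ->
    (forall k, v k \in [:: x; y]) ->
    #|[set k | u k == x]| = #|[set k | v k == x]| ->
    w u = w v.

(* Membership of the algebra (B * Z_p; wA) in the set (B; wB) [x] Z_p; for prime
   p, the field 'F_p is the ring Z_p. *)
Definition in_boxtimes (n p : nat) (B : Type) (wB : operation n B)
    (wA : operation n (B * 'F_p)) : Prop :=
  exists (f : {ffun 'I_n -> B} -> 'F_p) (a : 'I_n -> 'F_p),
  forall x : {ffun 'I_n -> B * 'F_p},
    (wA x).1 = wB [ffun k => (x k).1] /\
    (wA x).2 = f [ffun k => (x k).1] + \sum_(k < n) a k * (x k).2.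

(* Main.v *)
Require Import Defs.
From mathcomp Require Import all_boot all_algebra all_fingroup.
From Stdlib Require Import Classical_Prop.

(* The idempotent special WNU identities force w to act on the second coordinate
   as f + z_1 + ... + z_n, with n = 1 in F_p. Consider all term functions on the
   tuples with at most two values. The differences of second coordinates of terms
   with equal first coordinates form, for a term t0 that realizes as many of them
   as possible, a group L of functions by which t0 may be translated freely;
   every term built from t0 inherits this freedom. Applying w over all
   substitutions of each variable of t0 in turn yields a term T whose first
   coordinate is symmetric, as w^B is only ever applied to two-valued tuples. Modulo
   L the values of f may be rearranged, since permuting the arguments of w changes
   neither the first coordinate nor the sum of the second ones; expanding f by
   Moebius inversion around each of the n = 1 (mod p) base points then makes f
   symmetric modulo L. So the second coordinate of T is symmetric modulo L, and a
   translate of T is XY-symmetric. *)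

Set Implicit Arguments.
Unset Strict Implicit.
Unset Printing Implicit Defensive.

Import GRing.Theory.
Local Open Scope ring_scope.

(** * Permutations and subsets of equal size *)

Lemma eq_card_perm n (P Q : pred 'I_n) :
  #|P| = #|Q| -> exists s : {perm 'I_n}, forall k, P (s k) = Q k.
Proof.
move=> ePQ; have ePQC : #|predC P| = #|predC Q|.
  by apply: (@addnI #|P|); rewrite cardC ePQ cardC.
have /tuple_permP[s e]: perm_eq [tuple Q k | k < n] [tuple P k | k < n].
  apply/allP => b _ /=; rewrite !count_map; apply/eqP; apply: esym.
  have cE (X : pred 'I_n) :
      count (preim X (pred1 b)) (enum 'I_n) = if b then #|X| else #|predC X|.
    rewrite (_ : #|X| = count X (enum 'I_n)); last first.
      by rewrite cardE -size_filter enumT; congr size; apply: eq_filter.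
    rewrite (_ : #|predC X| = count (predC X) (enum 'I_n)); last first.
      by rewrite cardE -size_filter enumT; congr size; apply: eq_filter.
    by case: b; apply: eq_count => k /=; case: (X k).

  rewrite -!enumT; apply: etrans (cE P) _; rewrite ePQ ePQC; apply: esym (cE Q).
exists s => k.
have := congr1 (fun t : seq bool => nth false t k) e.
rewrite (nth_map k) ?size_enum_ord // nth_ord_enum.
by rewrite (nth_map k) ?size_enum_ord // nth_ord_enum tnth_mktuple.
Qed.

Lemma imset_perm_bij (T : finType) (s : {perm T}) :
  bijective (fun J : {set T} => s @: J).
Proof.
exists (fun J : {set T} => s @^-1: J) => J.
  by apply/setP => k; rewrite inE mem_imset //; apply: perm_inj.
apply/setP => k; apply/imsetP/idP => [[k' + ->]|kJ]; first by rewrite inE.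
by exists (s^-1%g k); rewrite ?inE permKV.
Qed.

(** * Moebius inversion on the subset lattice *)

Section AlternatingSums.
Variables (R : pzRingType) (T : finType).
Implicit Types (I J U : {set T}) (G : {set T} -> R).

(** Toggling [j] pairs the subsets of [J] into terms of opposite sign. *)
Lemma alternating_sum0 J j G :
    j \in J -> (forall I, G (j |: I) = G I) ->
  \sum_(I : {set T} | I \subset J) (-1) ^+ #|I| * G I = 0.
Proof.
move=> jJ Gj; rewrite (bigID (fun I : {set T} => j \in I)) /=.
rewrite (reindex_onto (fun I => j |: I) (fun I => I :\ j)) /=; last first.
  by move=> I /andP[_ jI]; rewrite setD1K.
apply/eqP; rewrite addr_eq0 -sumrN; apply/eqP/eq_big => [I|I].
  rewrite subUset sub1set jJ setU11 andbT /=; congr andb.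
  apply/eqP/idP => [<-|jI]; first by rewrite !inE eqxx.
  by rewrite setU1K.
case/andP=> _ /eqP e; have jI : j \notin I by rewrite -e !inE eqxx.
by rewrite cardsU1 jI exprS mulN1r mulNr Gj.
Qed.

Lemma moebius_powerset G U :
  \sum_(J : {set T} | J \subset U) \sum_(I : {set T} | I \subset J)
     (-1) ^+ #|I| * (-1) ^+ #|J| * G I = G U.
Proof.
pose c I J := (-1) ^+ #|I| * (-1) ^+ #|J| * G I.
rewrite (exchange_big_dep (fun I : {set T} => I \subset U)) /=; last first.
  by move=> J I JU IJ; apply: subset_trans JU.
rewrite (bigD1 U) //= [X in _ + X]big1 => [|I /andP[IU IneU]].
  rewrite addr0 (big_pred1 U) => [|J]; last by rewrite -eqEsubset eq_sym.
  by rewrite -exprD addnn -mul2n exprM sqrrN expr1n expr1n mul1r.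
(* For [I] other than [U], the signed sum over the [J] between [I] and [U] cancels by toggling a
   point [j] of [U] outside [I]. *)
have [j jU jI]: exists2 j, j \in U & j \notin I.
  by apply/subsetPn; apply: contra IneU => UI; rewrite eqEsubset IU.
transitivity (\sum_(J : {set T} | J \subset U)
    (-1) ^+ #|J| * (if I \subset J then (-1) ^+ #|I| * G I else 0)).
  rewrite big_mkcondr; apply: eq_bigr => J _; case: ifP; rewrite ?mulr0 //.
  by rewrite !mulrA (commr_sign ((-1) ^+ #|I|)).
apply: (alternating_sum0 jU) => J; congr (if _ then _ else _).
apply/subsetP/subsetP => IJ i iI; last by rewrite setU1r ?IJ.
by case/setU1P: (IJ i iI) => // e; rewrite -e iI in jI.
Qed.

End AlternatingSums.

(** * Two-valued tuples *)

Definition two_valued n (A : eqType) (u : 'I_n -> A) :=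
  exists x y, forall k, u k \in [:: x; y].

Lemma two_valued_other n (A : eqType) (u : 'I_n -> A) i :
  two_valued u -> exists c, forall k, u k \in [:: u i; c].
Proof.
case=> x [y uxy]; have := uxy i; rewrite !inE => /orP[/eqP->|/eqP->].
  by exists y.
by exists x => k; have := uxy k; rewrite !inE orbC.
Qed.

(** [v] factors through the values of [u]. The index [i] supplies a base value, which is all there
    is when [u] is constant. *)
Lemma two_valued_factor n (A A' : eqType) (u : 'I_n -> A) (v : 'I_n -> A')
    (i : 'I_n) :
  two_valued u -> (forall j k, u j = u k -> v j = v k) -> two_valued v.
Proof.
move=> /(two_valued_other i)[c uc] uv; exists (v i).
case: (pickP (fun j => u j != u i)) => [j uj|all_ui].
  exists (v j) => k; have := uc k; have := uc j.
  rewrite !inE (negPf uj) /= => /eqP {}uj /orP[]/eqP uk.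
    by rewrite (uv k i uk) eqxx.
  by rewrite (uv k j) ?eqxx ?orbT // uj.
by exists (v i) => k; have /negbFE/eqP/uv-> := all_ui k; rewrite inE eqxx.
Qed.

Lemma two_valued_reindex n m (A : eqType) (u : 'I_n -> A) (t : 'I_m -> 'I_n) :
  two_valued u -> two_valued (u \o t).
Proof. by case=> x [y uxy]; exists x, y => k; apply: uxy. Qed.

Lemma initial_segment_perm n (J : {set 'I_n}) :
  exists s : {perm 'I_n}, forall k, (s k \in J) = (k < #|J|)%N.
Proof.
have leJn : (#|J| <= n)%N by rewrite -[leqRHS]card_ord max_card.
have /eq_card_perm[s sP] :
  #|[pred k | k \in J]| = #|[pred k : 'I_n | (k < #|J|)%N]|.
  transitivity #|J|; first by apply: eq_card.
  move: #|J| leJn => m le_mn; rewrite -sum1_card.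
  rewrite (eq_bigl (fun k : 'I_n => (k < m)%N)) // (big_ord_narrow le_mn).
  by rewrite sum1_card card_ord.
by exists s => k; have := sP k.
Qed.

(** * Symmetrizing a function, exactly and modulo a group *)

Section Symmetrization.
Variables (n : nat) (B : eqType) (R : pzRingType).
Variable f : {ffun 'I_n -> B} -> R.
Variable arr : {set 'I_n} -> {perm 'I_n}.
Hypothesis arrP : forall J k, (arr J k \in J) = (k < #|J|)%N.

Implicit Types (a : 'I_n -> B) (i : 'I_n) (I J : {set 'I_n}).

Definition keep i I (k : 'I_n) : 'I_n := if k \in I then k else i.

(* The summand of [J] in the Moebius expansion of [f] at [a] around [a i], with the
   arguments rearranged by [s J]. On a two-valued [a] it vanishes unless all of
   [a] on [J] differs from [a i], so [s = arr] makes it depend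
   on [J] only through [#|J|] and this condition. *)
Definition alt_term (s : {set 'I_n} -> {perm 'I_n}) i J a : R :=
  \sum_(I : {set 'I_n} | I \subset J)
     (-1) ^+ #|I| * (-1) ^+ #|J| * f [ffun k => a (keep i I (s J k))].

(** Summing over all base points [i], instead of fixing one, is what allows invariance under
    permutations; it counts [f] with multiplicity [n], which is harmless when [n] is 1 in [R]. *)
Definition symmetrization a : R :=
  \sum_i \sum_(J : {set 'I_n} | i \notin J) alt_term arr i J a.

Lemma alt_term_sum i a :
  \sum_(J : {set 'I_n} | i \notin J) alt_term (fun=> 1%g) i J a
    = f [ffun k => a k].
Proof.
rewrite (eq_bigl (fun J : {set 'I_n} => J \subset [set~ i])); last first.
  by move=> J; rewrite subsetC sub1set inE.
rewrite (moebius_powerset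
  (fun I => f [ffun k => a (keep i I ((1%g : {perm 'I_n}) k))])).
congr f; apply/ffunP => k; rewrite !ffunE perm1 /keep !inE.
by case: eqP => [->|].
Qed.

Definition initial_alt_sum m b c : R :=
  \sum_(I : {set 'I_n} | I \subset [set k : 'I_n | (k < m)%N])
     (-1) ^+ #|I| * (-1) ^+ m * f [ffun k => if k \in I then c else b].

(** [arr J] carries the subsets of an initial segment to those of [J], and on [J] the tuple is
    constantly [c] if it avoids [a i]. If some [j] in [J] has [a j = a i], adding [j] to [I] changes
    no argument of [f] and the sum cancels. *)
Lemma alt_term_two_valued i J a c :
    (forall k, a k \in [:: a i; c]) ->
  alt_term arr i J a =
    if [forall j in J, a j != a i] then initial_alt_sum #|J| (a i) c else 0.
Proof.
move=> aic; case: ifPn => [/forall_inP aJ|].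
  rewrite /alt_term (reindex _ (onW_bij _ (imset_perm_bij (arr J)))) /=.
  apply: eq_big => [I|I IJ].
    apply/subsetP/subsetP => IJ k.
      by move=> kI; rewrite inE -arrP IJ // imset_f.
    by case/imsetP=> k' /IJ + ->; rewrite inE arrP.
  rewrite card_imset; last exact: perm_inj.
  congr (_ * f _); apply/ffunP => k; rewrite !ffunE /keep.
  rewrite mem_imset; last exact: perm_inj.
  case: ifP => // kI; have := aic (arr J k); rewrite !inE => /orP[|/eqP //].
  rewrite (negPf (aJ _ _)) //; apply: (subsetP IJ); exact: imset_f.
case/forall_inPn=> j jJ /negbNE/eqP aj.
pose G I := (-1) ^+ #|J| * f [ffun k => a (keep i I (arr J k))].
rewrite -[RHS](@alternating_sum0 _ _ J j G) //.
  by apply: eq_bigr => I _; rewrite mulrA.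
move=> I; congr (_ * f _); apply/ffunP => k; rewrite !ffunE /keep !inE.
by case: eqP => //= ->; case: ifP.
Qed.

(** The summands depend only on [a i], the other value, [#|J|] and whether [a] avoids [a i] on [J],
    so [s] merely permutes the pairs of [i] and [J]. *)
Lemma symmetrization_perm a (s : {perm 'I_n}) :
  two_valued a -> symmetrization (a \o s) = symmetrization a.
Proof.
move=> a2; rewrite /symmetrization [RHS](reindex_perm s); apply: eq_bigr => i _.
rewrite [RHS](reindex _ (onW_bij _ (imset_perm_bij s))) /=.
apply: eq_big => [J|J iJ]; first by rewrite mem_imset //; apply: perm_inj.
have [c aic] := two_valued_other (s i) a2.
rewrite (@alt_term_two_valued _ _ _ c); last by move=> k; apply: aic.
rewrite (@alt_term_two_valued _ _ _ c) //.
rewrite card_imset; last exact: perm_inj.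
congr (if _ then _ else _); apply/forall_inP/forall_inP => aJ j.
  by case/imsetP=> k kJ ->; apply: (aJ k kJ).
by move=> jJ; apply: (aJ (s j)); rewrite imset_f.
Qed.

(** An additive subgroup of functions; closure under pointwise equality stands in for functional
    extensionality. *)
Definition diff_closed (U : Type) (L : (U -> R) -> Prop) :=
  [/\ forall g h, g =1 h -> L g -> L h, L (fun=> 0)
    & forall g h, L g -> L h -> L (fun u => g u - h u)].

Lemma diff_closedN U (L : (U -> R) -> Prop) g :
  diff_closed L -> L g -> L (fun u => - g u).
Proof.
by case=> eqL L0 LB Lg; apply: eqL (LB _ _ L0 Lg) => u; rewrite sub0r.
Qed.

Lemma diff_closedD U (L : (U -> R) -> Prop) g h :
  diff_closed L -> L g -> L h -> L (fun u => g u + h u).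
Proof.
move=> clL Lg Lh; have [eqL _ LB] := clL.
by apply: eqL (LB _ _ Lg (diff_closedN clL Lh)) => u; rewrite opprK.
Qed.

Lemma diff_closed_sum U (L : (U -> R) -> Prop) (X : finType) (P : pred X) g :
  diff_closed L -> (forall x, P x -> L (g x)) ->
  L (fun u => \sum_(x | P x) g x u).
Proof.
move=> clL Lg; have [eqL L0 _] := clL.
elim: (index_enum X) => [|x r IHr].
  by apply: eqL L0 => u; rewrite big_nil.
case Px: (P x); last by apply: eqL IHr => u; rewrite big_cons Px.
by apply: eqL (diff_closedD clL (Lg x Px) IHr) => u; rewrite big_cons Px.
Qed.

Lemma diff_closed_sign U (L : (U -> R) -> Prop) m g :
  diff_closed L -> L g -> L (fun u => (-1) ^+ m * g u).
Proof.
move=> clL Lg; have [eqL _ _] := clL; elim: m => [|m IHm].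
  by apply: eqL Lg => u; rewrite mul1r.
by apply: eqL (diff_closedN clL IHm) => u; rewrite exprS mulN1r mulNr.
Qed.

Lemma symmetrization_congr (U : Type) (L : (U -> R) -> Prop)
    (a : U -> 'I_n -> B) :
    n%:R = 1 :> R -> diff_closed L ->
    (forall (t : 'I_n -> 'I_n) (s : {perm 'I_n}),
      L (fun u => f [ffun k => a u (t (s k))] - f [ffun k => a u (t k)])) ->
  L (fun u => f [ffun k => a u k] - symmetrization (a u)).
Proof.
move=> n1 clL Lperm; have [eqL _ _] := clL.
apply: (eqL (fun u => \sum_i \sum_(J : {set 'I_n} | i \notin J)
  \sum_(I : {set 'I_n} | I \subset J) (-1) ^+ #|I| * (-1) ^+ #|J| *
  (f [ffun k => a u (keep i I k)] - f [ffun k => a u (keep i I (arr J k))]))).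
  move=> u; rewrite /symmetrization.
  have -> : f [ffun k => a u k] = \sum_(i < n) f [ffun k => a u k].
    by rewrite sumr_const card_ord -mulr_natl n1 mul1r.
  rewrite -sumrB; apply: eq_bigr => i _.
  rewrite -(alt_term_sum i) -sumrB; apply: eq_bigr => J _.
  rewrite /alt_term -sumrB; apply: eq_bigr => I _; rewrite mulrBr.
  by congr (_ * f _ - _); apply/ffunP => k; rewrite !ffunE perm1.
apply: diff_closed_sum => // i _; apply: diff_closed_sum => // J _.
apply: diff_closed_sum => // I _.
apply: (eqL (fun u => (-1) ^+ #|I| * ((-1) ^+ #|J| *
    (f [ffun k => a u (keep i I k)]
      - f [ffun k => a u (keep i I (arr J k))])))).
  by move=> u; rewrite mulrA.
do 2![apply: diff_closed_sign => //].
apply: eqL (diff_closedN clL (Lperm (keep i I) (arr J))) => u.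
by rewrite opprB.
Qed.

End Symmetrization.

(** * Renaming variables in terms *)

Fixpoint rename n m k (r : 'I_m -> 'I_k) (t : term n m) : term n k :=
  match t with
  | Var i => Var n (r i)
  | App s => App (fun j => rename r (s j))
  end.

Lemma term_op_rename n m k (A : Type) (w : operation n A) (r : 'I_m -> 'I_k)
    (t : term n m) u :
  term_op w (rename r t) u = term_op w t [ffun i => u (r i)].
Proof.
elim: t => [i|s IHs] /=; first by rewrite ffunE.
by congr w; apply/ffunP => j; rewrite !ffunE IHs.
Qed.

Definition update n m (r : 'I_m -> 'I_n) (i : 'I_m) (j : 'I_n) (k : 'I_m) :=
  if k == i then j else r k.

(** * Translating the second coordinate of a term *)

Section Terms.
Variables (n : nat) (B : finType) (R : finNzRingType).
Variables (wB : operation n B) (wA : operation n (B * R)).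
Variable f : {ffun 'I_n -> B} -> R.
Hypothesis n_gt1 : (1 < n)%N.
Hypothesis n1 : n%:R = 1 :> R.
Hypothesis wAE : forall x : {ffun 'I_n -> B * R},
  wA x = (wB [ffun k => (x k).1], f [ffun k => (x k).1] + \sum_(k < n) (x k).2).
Hypothesis wB_idem : idempotent_operation wB.
Hypothesis f_const : forall b, f [ffun=> b] = 0.
Hypothesis wB_sym : XY_symmetric wB.

Local Notation point := {ffun 'I_n -> B * R}.
Local Notation ev := (term_op wA).
Implicit Types (t : term n n) (u : point) (g h : point -> R).

Lemma ev_App (s : 'I_n -> term n n) u :
  ev (App s) u = (wB [ffun k => (ev (s k) u).1],
    f [ffun k => (ev (s k) u).1] + \sum_(k < n) (ev (s k) u).2).
Proof.
rewrite /= wAE; congr (wB _, f _ + _); try by apply/ffunP => k; rewrite !ffunE.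
by apply: eq_bigr => k _; rewrite ffunE.
Qed.

Lemma wB_perm (a : 'I_n -> B) (s : {perm 'I_n}) :
  two_valued a -> wB [ffun k => a (s k)] = wB [ffun k => a k].
Proof.
case=> x [y axy]; apply: (wB_sym (x := x) (y := y)) => [k|k|].
- by rewrite ffunE.
- by rewrite ffunE.
rewrite -[LHS](card_imset _ (@perm_inj _ s)); apply: eq_card => k.
apply/imsetP/idP => [[j + ->]|]; first by rewrite !inE !ffunE.
by rewrite inE ffunE => ak; exists (s^-1%g k); rewrite ?inE ?ffunE permKV.
Qed.

Definition shift t g :=
  exists t', forall u, two_valued u -> ev t' u = ((ev t u).1, (ev t u).2 + g u).

Lemma shift_ext t g h :
  (forall u, two_valued u -> g u = h u) -> shift t g -> shift t h.
Proof. by move=> gh [t' t'P]; exists t' => u u2; rewrite t'P // gh. Qed.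

Lemma shift_sub t t' :
    (forall u, two_valued u -> (ev t u).1 = (ev t' u).1) ->
  shift t' (fun u => (ev t u).2 - (ev t' u).2).
Proof.
move=> tt'; exists t => u u2.
by rewrite [RHS]surjective_pairing /= -tt' // addrC subrK -surjective_pairing.
Qed.

Lemma shift_diff_closed t : diff_closed (shift t).
Proof.
split=> [g h gh||g h [t1 t1P] [t2 t2P]].
- by apply: shift_ext => u _; apply: gh.
- by exists t => u _; rewrite addr0 -surjective_pairing.
pose i := Ordinal (ltnW n_gt1); pose j := Ordinal n_gt1.
(* Since [n - 2] is -1 in [R], the second coordinates add up to those of [t1 + t - t2], a
   translation of [t] by [g - h]; all first coordinates agree, so idempotence applies and [f]
   vanishes. *)
exists (App (fun k => if k == i then t1 else if k == j then t else t2)) => u u2.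
rewrite ev_App; set a := [ffun k => _].
have -> : a = [ffun=> (ev t u).1].
  by apply/ffunP => k; rewrite !ffunE; do 2?case: ifP; rewrite ?t1P ?t2P.
rewrite wB_idem f_const add0r; congr (_, _).
transitivity (\sum_(k < n) ((ev t2 u).2
    + ((if k == i then (ev t1 u).2 - (ev t2 u).2 else 0)
       + (if k == j then (ev t u).2 - (ev t2 u).2 else 0)))).
  apply: eq_bigr => k _; case: eqP => [->|_] /=; first by rewrite addr0 addrC subrK.
  by case: eqP => _; rewrite add0r ?addr0 // addrC subrK.
rewrite !big_split /= sumr_const card_ord -mulr_natl n1 mul1r.
rewrite -!big_mkcond !big_pred1_eq addrA addrC [_ + (_ - _)]addrC subrK.
rewrite t1P // t2P //= opprD !addrA subrr add0r [- _ + _]addrC.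
by rewrite -!addrA [- _ + _]addrC.
Qed.

(** The second coordinate of each argument enters [wA] with coefficient 1, so translating one
    subterm translates the whole. *)
Lemma shift_App (s : 'I_n -> term n n) k g : shift (s k) g -> shift (App s) g.
Proof.
case=> t tP; exists (App (fun j => if j == k then t else s j)) => u u2.
rewrite !ev_App /=; set a := [ffun j => _]; set a' := [ffun j => _].
have -> : a = a'.
  by apply/ffunP => j; rewrite !ffunE; case: eqP => // ->; rewrite tP.
congr (_, _); rewrite -addrA; congr (_ + _).
rewrite (bigD1 k) //= eqxx tP //= [in RHS](bigD1 k) //= -!addrA; congr (_ + _).
by rewrite addrC; congr (_ + _); apply: eq_bigr => j /negPf->.
Qed.

(** There are finitely many candidate translations; applying [w] to two terms yields one that has
    the translations of both. *)
Lemma shift_max : exists t, forall t' g, shift t' g -> shift t g.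
Proof.
pose i := Ordinal (ltnW n_gt1); pose j := Ordinal n_gt1.
suff /(_ (enum {ffun point -> R}))[t tP] :
    forall s : seq {ffun point -> R}, exists t,
      forall t' (g : {ffun point -> R}), g \in s -> shift t' g -> shift t g.
  exists t => t' g t'g; apply: (@shift_ext _ (finfun g)) => [u _|].
    by rewrite ffunE.
  apply: (tP t'); first by rewrite mem_enum.
  by apply: shift_ext t'g => u _; rewrite ffunE.
elim=> [|g s [t tP]]; first by exists (Var n i).
have [[t1 t1g]|no] := classic (exists t1, shift t1 g); last first.
  exists t => t' h; rewrite inE => /orP[/eqP->|hs t'h]; last exact: tP t'h.
  by move=> t'g; case: no; exists t'.
pose c k := if k == i then t else t1.
have ci : c i = t by rewrite /c eqxx.
have cj : c j = t1 by rewrite /c.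
exists (App c) => t' h; rewrite inE => /orP[/eqP-> _|hs t'h].
  by apply: (@shift_App c j); rewrite cj.
by apply: (@shift_App c i); rewrite ci; apply: tP t'h.
Qed.

(** * Averaging a term over its substitutions *)

Section Averaging.
Variable t0 : term n n.

(* Averaging a variable over all its substitutions makes the first coordinate
   symmetric in it, and the choice [j = r i] keeps [t0] among the subterms. *)
Fixpoint average (l : seq 'I_n) (r : 'I_n -> 'I_n) : term n n :=
  match l with
  | [::] => rename r t0
  | i :: l' => App (fun j => average l' (update r i j))
  end.

Lemma shift_average g l r : r =1 id -> shift t0 g -> shift (average l r) g.
Proof.
move=> rE [t tP]; elim: l r rE => [|i l IHl] r rE /=.
  exists t => u u2; rewrite tP // term_op_rename.
  suff -> : [ffun k => u (r k)] = u by [].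
  by apply/ffunP => k; rewrite ffunE rE.
apply: (@shift_App _ i); apply: IHl => k.
by rewrite /update; case: eqP.
Qed.

(** The variables in [l] get overwritten, so [r] matters only outside [l]. *)
Lemma average_local l r r' u :
    (forall k, k \notin l -> u (r k) = u (r' k)) ->
  ev (average l r) u = ev (average l r') u.
Proof.
elim: l r r' => [|i l IHl] r r' rr' /=.
  rewrite !term_op_rename; congr (ev _ _).
  by apply/ffunP => k; rewrite !ffunE rr'.
congr wA; apply/ffunP => j; rewrite !ffunE; apply: IHl => k kl.
by rewrite /update; case: eqP => // /eqP ki; rewrite rr' // inE negb_or ki.
Qed.

Definition children l r i u (j : 'I_n) : B :=
  (ev (average l (update r i j)) u).1.

Lemma children_two_valued l r i u :
  two_valued u -> two_valued (children l r i u).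
Proof.
move=> u2; apply: (two_valued_factor (Ordinal n_gt1) u2) => j k ujk.
congr (_.1); apply: average_local => m _; rewrite /update.
by case: ifP.
Qed.

(** Permuting [u] permutes the two-valued tuple of children at each level, which [wB] does not
    notice. *)
Lemma average_perm l r u (s : {perm 'I_n}) : two_valued u ->
  (ev (average l r) [ffun k => u (s k)]).1 = (ev (average l (s \o r)) u).1.
Proof.
move=> u2; elim: l r => [|i l IHl] r.
  rewrite /= !term_op_rename; congr ((ev _ _).1).
  by apply/ffunP => k; rewrite !ffunE.
rewrite /average -/average !ev_App /=.
rewrite -(@wB_perm (children l (s \o r) i u) s); last exact: children_two_valued.
congr wB; apply/ffunP => j; rewrite !ffunE IHl /children.
congr (_.1); apply: average_local => k _.
by rewrite /update /=; case: eqP.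
Qed.

Variable arr : {set 'I_n} -> {perm 'I_n}.
Hypothesis arrP : forall J k, (arr J k \in J) = (k < #|J|)%N.

(** The second coordinate of [average] with every occurrence of [f] coming from averaging replaced
    by its symmetrization. *)
Fixpoint sym_average (l : seq 'I_n) (r : 'I_n -> 'I_n) u : R :=
  match l with
  | [::] => (ev (rename r t0) u).2
  | i :: l' => symmetrization f arr (children l' r i u)
                 + \sum_(j < n) sym_average l' (update r i j) u
  end.

Lemma symmetrization_ext (a a' : 'I_n -> B) :
  a =1 a' -> symmetrization f arr a = symmetrization f arr a'.
Proof.
move=> aa'; apply: eq_bigr => i _; apply: eq_bigr => J _; apply: eq_bigr => I _.
by congr (_ * f _); apply/ffunP => k; rewrite !ffunE.
Qed.

Lemma sym_average_local l r r' u :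
    (forall k, k \notin l -> u (r k) = u (r' k)) ->
  sym_average l r u = sym_average l r' u.
Proof.
elim: l r r' => [|i l IHl] r r' rr' /=.
  by rewrite (@average_local [::] r r').
have upd_rr' j k : k \notin l -> u (update r i j k) = u (update r' i j k).
  rewrite /update; case: eqP => // /eqP ki kl.
  by rewrite rr' // inE negb_or ki.
congr (_ + _); last by apply: eq_bigr => j _; apply: IHl; apply: upd_rr'.
apply: symmetrization_ext => j; congr (_.1); apply: average_local.
exact: upd_rr'.
Qed.

Lemma sym_average_perm l r u (s : {perm 'I_n}) : two_valued u ->
  sym_average l r [ffun k => u (s k)] = sym_average l (s \o r) u.
Proof.
move=> u2; elim: l r => [|i l IHl] r /=.
  rewrite /= !term_op_rename; congr ((ev _ _).2).
  by apply/ffunP => k; rewrite !ffunE.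
have upd_s j k : u ((s \o update r i j) k) = u (update (s \o r) i (s j) k).
  by rewrite /update /=; case: eqP.
congr (_ + _).
  have c2 := children_two_valued l (s \o r) i u2.
  rewrite -(symmetrization_perm f arrP s c2).
  apply: symmetrization_ext => j; rewrite /children average_perm //=.
  by congr (_.1); apply: average_local => k _; apply: upd_s.
rewrite [RHS](reindex_perm s); apply: eq_bigr => j _; rewrite IHl.
by apply: sym_average_local => k _; apply: upd_s.
Qed.

Lemma average_correction l r :
    (forall t g, shift t g -> shift t0 g) ->
  shift t0 (fun u => (ev (average l r) u).2 - sym_average l r u).
Proof.
move=> t0max; have clt0 := shift_diff_closed t0; have [_ L0 _] := clt0.
elim: l r => [|i l IHl] r.
  by apply: shift_ext L0 => u _; rewrite subrr.
have Lchildren (t : 'I_n -> 'I_n) (s : {perm 'I_n}) :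
    shift t0 (fun u => f [ffun k => children l r i u (t (s k))]
                       - f [ffun k => children l r i u (t k)]).
  (* [q (t \o s)] and [q t] have equal first coordinates by symmetry of [wB] and equal sums of
     second coordinates of their arguments; only the values of [f] differ, and maximality of [t0]
     applies to that difference. *)
  pose q (e : 'I_n -> 'I_n) := App (fun k => average l (update r i (e k))).
  apply: t0max (q t) _ _; apply: shift_ext (shift_sub (t := q (t \o s)) _) => u u2.
    rewrite !ev_App /= [X in _ + X - _](_ : _ =
      \sum_(k < n) (ev (average l (update r i (t k))) u).2); last first.
      by rewrite [RHS](reindex_perm s).
    by rewrite opprD addrACA subrr addr0.
  rewrite !ev_App /=.
  apply: (@wB_perm (children l r i u \o t) s).
  exact: two_valued_reindex (children_two_valued l r i u2).
have LE := symmetrization_congr arr n1 clt0 Lchildren.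
have Lsum := diff_closed_sum (P := predT) clt0
  (fun (j : 'I_n) _ => IHl (update r i j)).
apply: shift_ext (diff_closedD clt0 LE Lsum) => u u2.
by rewrite /average -/average ev_App /= sumrB addrACA -opprD.
Qed.

End Averaging.

Lemma XY_symmetric_term : exists t : term n n, XY_symmetric (term_op wA t).
Proof.
have /fin_all_exists[arr arrP] := @initial_segment_perm n.
have [t0 t0max] := shift_max.
pose l := enum 'I_n; pose T := average t0 l id.
(* This translation replaces the second coordinate of [T] by [sym_average]. *)
have [t tP] : shift T (fun u => sym_average t0 arr l id u - (ev T u).2).
  apply: shift_average => //; have clt0 := shift_diff_closed t0.
  have [eqL _ _] := clt0.
  apply: eqL (diff_closedN clt0 (average_correction arr l id t0max)) => u.
  by rewrite opprB.
exists t => x y u v uxy vxy uv.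
have /eq_card_perm[s sP] : #|[pred k | u k == x]| = #|[pred k | v k == x]|.
  by rewrite !cardsE in uv.
have -> : v = [ffun k => u (s k)].
  apply/ffunP => k; rewrite ffunE; have /= uv_k := sP k.
  move: (vxy k) (uxy (s k)); rewrite !inE uv_k.
  case vk: (v k == x) uv_k; first by move/eqP-> => _ _; apply/eqP.
  by move=> /= _ /eqP-> /eqP->.
have u2 : two_valued u by exists x, y.
have us2 : two_valued [ffun k => u (s k)] by exists x, y => k; rewrite ffunE.
rewrite !tP // ![_ + (_ - _)]addrC !subrK average_perm // sym_average_perm //.
(* As [l] lists every variable, the renaming by [s] has no effect. *)
have in_l k : k \notin l -> u ((s \o id) k) = u (id k) by rewrite mem_enum.
by rewrite (average_local t0 in_l) (sym_average_local t0 arr in_l).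
Qed.

End Terms.

(** * Coefficients of the operation, and the theorem *)

(* The [WNU] identity makes all coefficients equal to some [a] with [n a = 1], and
   specialness gives [a = a ^ 2]. *)
Lemma special_coefficients n (B : finType) (F : fieldType) (b : B)
    (w : operation n (B * F)) (f : {ffun 'I_n -> B} -> F) (a : 'I_n -> F) :
    (forall x, (w x).2 = f [ffun k => (x k).1] + \sum_(k < n) a k * (x k).2) ->
    (forall y (x : {ffun 'I_n -> B * F}), (forall k, (x k).1 = y) -> (w x).1 = y) ->
    idempotent_operation w -> weak_near_unanimity w -> special_operation w ->
  (forall c, f [ffun=> c] = 0) /\ ((forall k, a k = 1) /\ n%:R = 1 :> F).
Proof.
move=> w2 w1 w_idem w_wnu w_special.
have f0 c : f [ffun=> c] = 0.
  have /(congr1 snd) := w_idem (c, 0); rewrite w2 /= big1 ?addr0 => [<-|k _].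
    by congr f; apply/ffunP => k; rewrite !ffunE.
  by rewrite ffunE mulr0.
have w_fiber (x : {ffun 'I_n -> B * F}) :
    (forall k, (x k).1 = b) -> w x = (b, \sum_(k < n) a k * (x k).2).
  move=> xb; rewrite [w x]surjective_pairing (w1 b) // w2.
  suff -> : [ffun k => (x k).1] = [ffun=> b] by rewrite f0 add0r.
  by apply/ffunP => k; rewrite !ffunE xb.
have w_delta z i : w (all_but_one (b, 0) (b, z) i) = (b, a i * z).
  rewrite w_fiber => [|k]; last by rewrite ffunE; case: eqP.
  rewrite (bigD1 i) //= big1 ?addr0 ?ffunE ?eqxx // => k /negPf ki.
  by rewrite ffunE ki mulr0.
have aE i j : a i = a j.
  by have /(congr1 snd) := w_wnu (b, 0) (b, 1) i j; rewrite !w_delta /= !mulr1.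
have sum_a : \sum_(k < n) a k = 1.
  have /(congr1 snd) := w_idem (b, 1); rewrite w_fiber /= => [<-|k].
    by apply: eq_bigr => k _; rewrite ffunE mulr1.
  by rewrite ffunE.
have n_gt0 : (0 < n)%N.
  case: (posnP n) => // n0; move: sum_a; rewrite big1 => [/esym/eqP|k _].
    by rewrite oner_eq0.
  by have := ltn_ord k; rewrite {2}n0.
have lt_last : (n.-1 < n)%N by rewrite prednK.
pose l := Ordinal lt_last.
have al_sq : a l = a l * a l.
  have /(congr1 snd) := w_special (b, 0) (b, 1) l (prednK n_gt0).
  by rewrite !w_delta /= mulr1.
have nal : n%:R * a l = 1.
  by rewrite -[RHS]sum_a (eq_bigr (fun=> a l)) // sumr_const card_ord mulr_natl.
have al_neq0 : a l != 0.
  by apply: contra_eq_neq nal => ->; rewrite mulr0 eq_sym oner_eq0.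
have al1 : a l = 1 by apply: (mulfI al_neq0); rewrite -al_sq mulr1.
split=> //; split=> [k|]; first by rewrite (aE k l).
by rewrite -[RHS]nal al1 mulr1.
Qed.

Theorem theorem4p15 (n p : nat) (B : finType) (wB : operation n B)
    (wA : operation n (B * 'F_p)%type) :
  prime p ->
  in_boxtimes wB wA ->
  in_V wA ->
  XY_symmetric wB ->
  exists t : term n n, XY_symmetric (term_op wA t).
Proof.
move=> _ [f [a wAE]] [wA_idem wA_wnu wA_special] wB_sym.
have [b _|B0] := pickP (@predT B); last first.
  (* Over an empty carrier any term will do. *)
  by exists (App (@Var n n)) => -[c z]; have := B0 c.
have wB_idem : idempotent_operation wB.
  move=> c; have := (wAE [ffun=> (c, 0)]).1; rewrite wA_idem /= => {2}->.
  by congr wB; apply/ffunP => k; rewrite !ffunE.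
have [|f0 [a1 n1]] := special_coefficients b (fun x => (wAE x).2) _
    wA_idem wA_wnu wA_special.
  move=> y x xy; rewrite (wAE x).1 -[RHS]wB_idem.
  by congr wB; apply/ffunP => k; rewrite !ffunE xy.
have [n_gt1|n_le1] := ltnP 1 n.
  apply: (XY_symmetric_term n_gt1 n1 _ wB_idem f0 wB_sym) => x.
  rewrite [LHS]surjective_pairing !(wAE x).1 (wAE x).2.
  by congr (_, _ + _); apply: eq_bigr => k _; rewrite a1 mul1r.
(* With at most one position, the number of entries equal to [x] determines the tuple, so
   [u = v]. *)
exists (App (@Var n n)) => x y u v uxy vxy uv; congr (term_op wA _ _).
apply/ffunP => k; move: (uxy k) (vxy k); rewrite !inE.
have val0 (j : 'I_n) : j = 0%N :> nat.
  by apply/eqP; rewrite -leqn0 -ltnS (leq_trans (ltn_ord j)).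
have single (P : pred 'I_n) : #|[set j | P j]| = P k.
  rewrite (_ : [set j | P j] = if P k then [set k] else set0).
    by case: (P k); rewrite ?cards1 ?cards0.
  apply/setP => j; have -> : j = k.
    by apply: val_inj; rewrite /= !val0.
  by rewrite inE; case: (P k); rewrite !inE ?eqxx.
move: uv; rewrite !single.
case: (u k =P x) => [->|_]; case: (v k =P x) => [-> //|_] //=.
by move=> _ /eqP-> /eqP->.
Qed.
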